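(* Let $(V,\rho,\alpha_V,\beta_V)$ be a representation of a regular multiplicative BiHom-Jordan superalgebra $(\mathfrak J,\cdot,\alpha,\beta)$ and let $T:V\to\mathfrak J$ be a homogeneous $\mathcal O$-operator of $\mathfrak J$ associated to $\rho$. Define on $V$ the product $$u\circ_V v=(-1)^{|T|(|u|+|T|)}\rho(T(u))v,\qquad u,v\in\mathcal H(V).$$ Then: 1. If $T$ is even, $(V,\circ_V,\alpha_V,\beta_V)$ is a BiHom-pre-Jordan superalgebra. 2. If $T$ is odd, the product $\bullet_V$ on $sV$ defined by $su\bullet_V sv=s(u\circ_V v)$ makes $(sV,\bullet_V,\alpha_V^s,\beta_V^s)$ a BiHom-pre-Jordan superalgebra, where $\alpha_V^s(su)=s(\alpha_V(u))$ and $\beta_V^s(su)=s(\beta_V(u))$.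
   Context: Vector spaces are over an algebraically closed field $\mathbb K$ of characteristic $0$. For a $\mathbb Z_2$-graded vector space $W$, $\mathcal H(W)$ denotes the set of homogeneous elements and $|x|$ the parity of $x$; even (bi)linear maps preserve the $\mathbb Z_2$-degree; $|T|$ is the parity of a homogeneous linear map $T$. For $V=V_{\bar0}\oplus V_{\bar1}$, $sV$ is the $\mathbb Z_2$-graded space with $(sV)_{\bar0}=V_{\bar1}$, $(sV)_{\bar1}=V_{\bar0}$, and $s:V\to sV$ is the odd linear map sending each element to the same element with opposite parity. A BiHom-Jordan superalgebra is a quadruple $(\mathfrak J,\cdot,\alpha,\beta)$ with $\mathfrak J$ a $\mathbb Z_2$-graded vector space, $\cdot$ an even bilinear product and $\alpha,\beta:\mathfrak J\to\mathfrak J$ two even commuting linear maps such that for all $x,y,z,t\in\mathcal H(\mathfrak J)$: $\beta(x)\cdot\alpha(y)=(-1)^{|x||y|}\beta(y)\cdot\alpha(x)$, and $$\circlearrowleft_{x,y,t}(-1)^{|t|(|x|+|z|)}ass_{\alpha,\beta}\big(\beta^2(x)\cdot\alpha\beta(y),\alpha^2\beta(z),\alpha^3(t)\big)=0,$$ with cyclic sum over $(x,y,t)$ and $ass_{\alpha,\beta}(a,b,c)=(a\cdot b)\cdot\beta(c)-\alpha(a)\cdot(b\cdot c)$. It is multiplicative if $\alpha,\beta$ preserve the product and regular if they are superalgebra automorphisms. A representation of a regular multiplicative BiHom-Jordan superalgebra is a quadruple $(V,\rho,\alpha_V,\beta_V)$ with $V$ a $\mathbb Z_2$-graded vector space, $\rho:\mathfrak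 J\to\mathfrak{gl}(V)$ an even linear map, and $\alpha_V,\beta_V$ two even commuting linear automorphisms of $V$, such that for all $x,y,z\in\mathcal H(\mathfrak J)$ (with $\sum_{x,y,z}$ the cyclic sum over $(x,y,z)$): (R1) $\alpha_V\rho(x)=\rho(\alpha(x))\alpha_V$ and $\beta_V\rho(x)=\rho(\beta(x))\beta_V$; (R2) $\sum_{x,y,z}(-1)^{|x||z|}\rho\big(\alpha\beta^2(x)\cdot\alpha^2\beta(y)\big)\rho(\alpha^2\beta(z))\alpha_V^3=(-1)^{|x||z|}\rho\big((\beta^2(x)\cdot\alpha\beta(y))\cdot\alpha^2\beta(z)\big)\alpha_V^3\beta_V+(-1)^{|z|(|x|+|y|)}\rho(\alpha^2\beta^2(x))\rho(\alpha^2\beta(z))\rho(\alpha^2(y))\alpha_V^3\beta_V^{-1}+(-1)^{|x||y|}\rho(\alpha^2\beta^2(y))\rho(\alpha^2\beta(z))\rho(\alpha^2(x))\alpha_V^3\beta_V^{-1}$; (R3) $\sum_{x,y,z}(-1)^{|x||z|}\rho(\alpha^2\beta^2(x))\rho\big(\alpha\beta(y)\cdot\alpha^2(z)\big)\alpha_V^3=\sum_{x,y,z}(-1)^{|x||z|}\rho\big(\alpha\beta^2(x)\cdot\alpha^2\beta(y)\big)\rho(\alpha^2\beta(z))\alpha_V^3$. A homogeneous linear map $T:V\to\mathfrak J$ is an $\mathcal O$-operator of $\mathfrak J$ associated to $\rho$ if $\alpha T=T\alpha_V$, $\beta T=T\beta_V$ and for all $u,v\in\mathcal H(V)$ $$T(u)\cdot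 T(v)=T\big((-1)^{|T|(|T|+|u|)}\rho(T(u))v+(-1)^{|u|(|v|+|T|)}\rho(T(\alpha_V^{-1}\beta_V(v)))\alpha_V\beta_V^{-1}(u)\big).$$ A BiHom-pre-Jordan superalgebra is a quadruple $(A,\circ,\alpha,\beta)$ with $A$ a $\mathbb Z_2$-graded vector space, $\circ$ an even bilinear product and $\alpha,\beta:A\to A$ two even commuting bijective linear maps such that, with $x\ast y=x\circ y+(-1)^{|x||y|}\alpha^{-1}\beta(y)\circ\alpha\beta^{-1}(x)$, for all $x,y,z,t\in\mathcal H(A)$: (P1) $\alpha(x\circ y)=\alpha(x)\circ\alpha(y)$ and $\beta(x\circ y)=\beta(x)\circ\beta(y)$; (P2) $\sum_{x,y,z}(-1)^{|x||z|}\big(\alpha\beta^2(x)\ast\alpha^2\beta(y)\big)\circ(\alpha^2\beta(z)\circ\alpha^3(t))=(-1)^{|x||z|}\big((\beta^2(x)\ast\alpha\beta(y))\ast\alpha^2\beta(z)\big)\circ\alpha^3\beta(t)+(-1)^{|z|(|x|+|y|)}\alpha^2\beta^2(x)\circ\big(\alpha^2\beta(z)\circ(\alpha^2(y)\circ\alpha^3\beta^{-1}(t))\big)+(-1)^{|x||y|}\alpha^2\beta^2(y)\circ\big(\alpha^2\beta(z)\circ(\alpha^2(x)\circ\alpha^3\beta^{-1}(t))\big)$; (P3) $\sum_{x,y,z}(-1)^{|x||z|}\alpha^2\beta^2(x)\circ\big((\alpha\beta(y)\ast\alpha^2(z))\circ\alpha^3(t)\big)=\sum_{x,y,z}(-1)^{|x||z|}\big(\alpha\beta^2(x)\ast\alpha^2\beta(y)\big)\circ(\alpha^2\beta(z)\circ\alpha^3(t))$.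 *)

(* Defs.v *)
From mathcomp Require Import all_boot all_algebra.

Set Implicit Arguments.
Unset Strict Implicit.
Unset Printing Implicit Defensive.

Import GRing.Theory.
Local Open Scope ring_scope.

(* The underlying lmodType need not be finite-dimensional. The maps
   [hproj false] and [hproj true] are the projections onto the summands of
   W = W_0 (+) W_1; they are determined by [hpart]. Parities are booleans,
   [true] being the odd one. *)
Record superspace (K : fieldType) := Superspace {
  scarrier :> lmodType K;
  hpart : bool -> {pred scarrier};
  hproj : bool -> scarrier -> scarrier;
  hpart_submod : forall i, submod_closed (hpart i);
  hproj_in : forall i x, hproj i x \in hpart i;
  hproj_sum : forall x, hproj false x + hproj true x = x;
  hpart_cap : forall x, x \in hpart false -> x \in hpart true -> x = 0
}.

Arguments hpart {K} s _ : rename.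
Arguments hproj {K} s _ _ : rename.
Arguments hpart_submod {K} s i : rename.
Arguments hproj_in {K} s i x : rename.
Arguments hproj_sum {K} s x : rename.
Arguments hpart_cap {K} s [x] : rename.

(* H(W). The zero vector occurs once with each parity, which is harmless since
   every identity below is multilinear. *)
Record homog (K : fieldType) (W : superspace K) := Hom {
  hval :> W;
  par : bool;
  hvalP : hval \in hpart W par
}.

Section Superspaces.
Variable K : fieldType.

Definition is_bilinear (U V W : lmodType K) (f : U -> V -> W) : Prop :=
  (forall u, linear (f u)) /\ (forall v, linear (f^~ v)).

Definition homogeneous_map (V W : superspace K) (p : bool) (f : V -> W) : Prop :=
  forall i x, x \in hpart V i -> f x \in hpart W (i (+) p).

Definition even_map (V W : superspace K) (f : V -> W) : Prop :=
  homogeneous_map false f.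

Definition even_bimap (U V W : superspace K) (f : U -> V -> W) : Prop :=
  forall i j x y, x \in hpart U i -> y \in hpart V j ->
    f x y \in hpart W (i (+) j).

(* Biadditive extension of a formula [F |x| |y| x y] that is only given for
   homogeneous x and y; see [bilin_extE]. *)
Definition bilin_ext (U V W : superspace K)
    (F : bool -> bool -> U -> V -> W) (x : U) (y : V) : W :=
  \sum_(i : bool) \sum_(j : bool) F i j (hproj U i x) (hproj V j y).

Definition cyclic_sum (X : Type) (W : zmodType)
    (F : X -> X -> X -> W) (x y z : X) : W :=
  F x y z + F y z x + F z x y.

Lemma hproj_hom (W : superspace K) (x : homog W) (i : bool) :
  hproj W i x = if i == par x then hval x else 0.
Proof.
case: x => x p xp /=.
have sub q a b : a \in hpart W q -> b \in hpart W q -> a - b \in hpart W q.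
  move=> aq bq; have [_ cl] := hpart_submod W q.
  by rewrite addrC -scaleN1r; apply: cl.
have e := hproj_sum W x; have h0 := hproj_in W false x.
have h1 := hproj_in W true x.
have e0 : x - hproj W false x = hproj W true x by rewrite -{1}e addrC addKr.
have e1 : x - hproj W true x = hproj W false x by rewrite -{1}e addrK.
case: p xp => xp.
  have z : hproj W false x = 0.
    by apply: hpart_cap => //; rewrite -e1; apply: sub.
  by case: i => //=; rewrite -e0 z subr0.
have z : hproj W true x = 0.
  by apply: hpart_cap => //; rewrite -e0; apply: sub.
by case: i => //=; rewrite -e1 z subr0.
Qed.

Lemma bilin_extE (U V W : superspace K) (F : bool -> bool -> U -> V -> W)
    (x : homog U) (y : homog V) :
  (forall i j v, F i j 0 v = 0) -> (forall i j u, F i j u 0 = 0) ->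
  bilin_ext F x y = F (par x) (par y) x y.
Proof.
move=> F0l F0r; rewrite /bilin_ext (bigD1 (par x)) //= (bigD1 (par y)) //=.
rewrite !hproj_hom !eqxx big1 => [|j jy]; last first.
  by rewrite hproj_hom (negPf jy) F0r.
rewrite addr0 big1 ?addr0 // => i ix; apply: big1 => j _.
by rewrite hproj_hom (negPf ix) F0l.
Qed.

(* sV has the same underlying space as V, so that s : V -> sV is the identity map. *)
Definition shift (V : superspace K) : superspace K :=
  @Superspace K V (fun i => hpart V (~~ i)) (fun i => hproj V (~~ i))
    (fun i => hpart_submod V (~~ i)) (fun i => hproj_in V (~~ i))
    (fun x => etrans (addrC _ _) (hproj_sum V x))
    (fun x x1 x0 => hpart_cap V x0 x1).

Definition s_map (V : superspace K) (x : V) : shift V := x.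
Definition s_inv (V : superspace K) (x : shift V) : V := x.

End Superspaces.

Section Inverse.
Variables (K : fieldType) (W : superspace K) (f : W -> W).

Lemma bij_surj : bijective f -> forall y, exists x, f x == y.
Proof. by case=> g _ gK y; exists (g y); rewrite gK. Qed.

Definition bij_inv (fb : bijective f) (y : W) : W := xchoose (bij_surj fb y).

Lemma bij_invK (fb : bijective f) : cancel (bij_inv fb) f.
Proof. by move=> y; apply/eqP/(xchooseP (bij_surj fb y)). Qed.

Lemma bijK_inv (fb : bijective f) : cancel f (bij_inv fb).
Proof. by move=> x; apply: (bij_inj fb); rewrite bij_invK. Qed.

End Inverse.

Section BiHomJordan.
Variables (K : fieldType) (J : superspace K) (mul : J -> J -> J) (a b : J -> J).

Definition ass (x y z : J) : J := mul (mul x y) (b z) - mul (a x) (mul y z).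

Record is_bihom_jordan : Prop := IsBiHomJordan {
  jor_bilinear : is_bilinear mul;
  jor_even : even_bimap mul;
  jor_a_linear : linear a;
  jor_b_linear : linear b;
  jor_a_even : even_map a;
  jor_b_even : even_map b;
  jor_ab : forall x, a (b x) = b (a x);
  jor_comm : forall x y : homog J,
    mul (b x) (a y) = (-1) ^+ (par x * par y) *: mul (b y) (a x);
  jor_ass : forall x y z t : homog J,
    cyclic_sum (fun x y t : homog J =>
      (-1) ^+ (par t * (par x + par z)) *:
        ass (mul (b (b x)) (a (b y))) (a (a (b z))) (a (a (a t)))) x y t = 0
}.

Definition is_multiplicative : Prop :=
  {morph a : x y / mul x y} /\ {morph b : x y / mul x y}.

Definition superalgebra_automorphism (f : J -> J) : Prop :=
  [/\ linear f, even_map f, bijective f & {morph f : x y / mul x y}].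

Definition is_regular : Prop :=
  superalgebra_automorphism a /\ superalgebra_automorphism b.

End BiHomJordan.

Section Representation.
Variables (K : fieldType) (J : superspace K) (mul : J -> J -> J) (a b : J -> J).
Variables (V : superspace K) (rho : J -> V -> V) (aV bV : V -> V).

(* [rho x] is an element of gl(V), whose degree-i part consists of the
   endomorphisms sending V_j to V_(i+j) for all j: linearity of J -> gl(V) and
   of each [rho x] is [rep_bilinear], evenness of J -> gl(V) is [rep_even]. *)
Record is_representation : Prop := IsRepresentation {
  rep_bilinear : is_bilinear rho;
  rep_even : even_bimap rho;
  rep_a_linear : linear aV;
  rep_b_linear : linear bV;
  rep_a_even : even_map aV;
  rep_b_even : even_map bV;
  rep_a_bij : bijective aV;
  rep_b_bij : bijective bV;
  rep_ab : forall v, aV (bV v) = bV (aV v);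
  rep_R1a : forall (x : homog J) v, aV (rho x v) = rho (a x) (aV v);
  rep_R1b : forall (x : homog J) v, bV (rho x v) = rho (b x) (bV v);
  rep_R2 : forall (x y z : homog J) v,
    let bVi := bij_inv rep_b_bij in
    cyclic_sum (fun x y z : homog J =>
      (-1) ^+ (par x * par z) *:
        rho (mul (a (b (b x))) (a (a (b y))))
            (rho (a (a (b z))) (aV (aV (aV v))))) x y z
    = (-1) ^+ (par x * par z) *:
        rho (mul (mul (b (b x)) (a (b y))) (a (a (b z))))
            (aV (aV (aV (bV v))))
    + (-1) ^+ (par z * (par x + par y)) *:
        rho (a (a (b (b x)))) (rho (a (a (b z))) (rho (a (a y))
          (aV (aV (aV (bVi v))))))
    + (-1) ^+ (par x * par y) *:
        rho (a (a (b (b y)))) (rho (a (a (b z))) (rho (a (a x))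
          (aV (aV (aV (bVi v))))));
  rep_R3 : forall (x y z : homog J) v,
    cyclic_sum (fun x y z : homog J =>
      (-1) ^+ (par x * par z) *:
        rho (a (a (b (b x))))
            (rho (mul (a (b y)) (a (a z))) (aV (aV (aV v))))) x y z
    = cyclic_sum (fun x y z : homog J =>
      (-1) ^+ (par x * par z) *:
        rho (mul (a (b (b x))) (a (a (b y))))
            (rho (a (a (b z))) (aV (aV (aV v))))) x y z
}.

(* p is the parity |T|. *)
Record is_O_operator (rep : is_representation) (p : bool) (T : V -> J) : Prop :=
IsOOperator {
  O_linear : linear T;
  O_homogeneous : homogeneous_map p T;
  O_a : forall v, a (T v) = T (aV v);
  O_b : forall v, b (T v) = T (bV v);
  O_mul : forall u v : homog V,
    let aVi := bij_inv (rep_a_bij rep) in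
    let bVi := bij_inv (rep_b_bij rep) in
    mul (T u) (T v)
    = T ((-1) ^+ (p * (p + par u)) *: rho (T u) v
         + (-1) ^+ (par u * (par v + p)) *:
             rho (T (aVi (bV v))) (aV (bVi u)))
}.

Definition O_prod (p : bool) (T : V -> J) : V -> V -> V :=
  bilin_ext (fun i j u v => (-1) ^+ (p * (i + p)) *: rho (T u) v).

Lemma O_prodE (rep : is_representation) (p : bool) (T : V -> J) (u v : homog V) :
  linear T -> O_prod p T u v = (-1) ^+ (p * (par u + p)) *: rho (T u) v.
Proof.
have lin0 (U W : lmodType K) (f : U -> W) : linear f -> f 0 = 0.
  by move=> fl; have := fl (-1) 0 0; rewrite scaler0 addr0 scaleN1r addNr.
have [rr rl] := rep_bilinear rep; move=> Tl.
apply: (@bilin_extE K V V V) => i j w; last by rewrite (lin0 _ _ _ (rr _)) scaler0.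
by rewrite (lin0 _ _ _ Tl) (lin0 _ _ _ (rl w)) scaler0.
Qed.

End Representation.

Section BiHomPreJordan.
Variables (K : fieldType) (A : superspace K) (op : A -> A -> A) (a b : A -> A).

(* x * y, extended from homogeneous x and y; [ai] and [bi] stand for the
   inverses of [a] and [b]. *)
Definition pre_star (ai bi : A -> A) : A -> A -> A :=
  bilin_ext (fun i j x y =>
    op x y + (-1) ^+ (i * j) *: op (ai (b y)) (a (bi x))).

Record is_bihom_prejordan : Prop := IsBiHomPreJordan {
  pre_bilinear : is_bilinear op;
  pre_even : even_bimap op;
  pre_a_linear : linear a;
  pre_b_linear : linear b;
  pre_a_even : even_map a;
  pre_b_even : even_map b;
  pre_a_bij : bijective a;
  pre_b_bij : bijective b;
  pre_ab : forall x, a (b x) = b (a x);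
  pre_P1a : forall x y : homog A, a (op x y) = op (a x) (a y);
  pre_P1b : forall x y : homog A, b (op x y) = op (b x) (b y);
  pre_P2 : forall x y z t : homog A,
    let bi := bij_inv pre_b_bij in
    let star := pre_star (bij_inv pre_a_bij) bi in
    cyclic_sum (fun x y z : homog A =>
      (-1) ^+ (par x * par z) *:
        op (star (a (b (b x))) (a (a (b y))))
           (op (a (a (b z))) (a (a (a t))))) x y z
    = (-1) ^+ (par x * par z) *:
        op (star (star (b (b x)) (a (b y))) (a (a (b z)))) (a (a (a (b t))))
    + (-1) ^+ (par z * (par x + par y)) *:
        op (a (a (b (b x)))) (op (a (a (b z))) (op (a (a y))
          (a (a (a (bi t))))))
    + (-1) ^+ (par x * par y) *:
        op (a (a (b (b y)))) (op (a (a (b z))) (op (a (a x))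
          (a (a (a (bi t))))));
  pre_P3 : forall x y z t : homog A,
    let star := pre_star (bij_inv pre_a_bij) (bij_inv pre_b_bij) in
    cyclic_sum (fun x y z : homog A =>
      (-1) ^+ (par x * par z) *:
        op (a (a (b (b x))))
           (op (star (a (b y)) (a (a z))) (a (a (a t))))) x y z
    = cyclic_sum (fun x y z : homog A =>
      (-1) ^+ (par x * par z) *:
        op (star (a (b (b x))) (a (a (b y))))
           (op (a (a (b z))) (a (a (a t))))) x y z
}.

End BiHomPreJordan.

Definition shift_map (K : fieldType) (V : superspace K) (f : V -> V) :
    shift V -> shift V :=
  fun x => s_map (f (s_inv x)).

Definition shift_prod (K : fieldType) (V : superspace K) (op : V -> V -> V) :
    shift V -> shift V -> shift V :=
  fun x y => s_map (op (s_inv x) (s_inv y)).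

(* Main.v *)
Require Import Defs.
From mathcomp Require Import all_boot all_algebra.
Import GRing.Theory.
Local Open Scope ring_scope.

(** In the grading of [V] (for [T] even) or of [sV] (for [T] odd), [T] is an
even map, [rho] is still a representation, and the product of [u] and [v] is
[(-1)^(|T||u|) rho(T u) v]. The O-operator identity then says exactly that [T]
maps the star product to the product of [J]. Hence each term of (P2) and (P3) at
(x, y, z, t) is the corresponding term of (R2) and (R3) at (T x, T y, T z)
applied to t, multiplied by the common sign [(-1)^(|T|(|x|+|y|+|z|))]. *)

Lemma linear_fun0 {K : fieldType} {U W : lmodType K} {f : U -> W} :
  linear f -> f 0 = 0.
Proof.
by move=> fl; have := fl (-1) 0 0; rewrite scaler0 addr0 scaleN1r addNr.
Qed.

Lemma linear_funD {K : fieldType} {U W : lmodType K} {f : U -> W} :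
  linear f -> {morph f : x y / x + y}.
Proof. by move=> fl x y; have := fl 1 x y; rewrite !scale1r. Qed.

Lemma linear_funZ {K : fieldType} {U W : lmodType K} {f : U -> W} :
  linear f -> forall k, {morph f : x / k *: x}.
Proof.
by move=> fl k x; have := fl k x 0; rewrite !addr0 (linear_fun0 fl) addr0.
Qed.

(** * Projections and even bijections in a graded space *)

Section Grading.
Context {K : fieldType} {W : superspace K}.

Lemma hpartD {i} {x y : W} :
  x \in hpart W i -> y \in hpart W i -> x + y \in hpart W i.
Proof.
by have [_ cl] := hpart_submod W i => xi yi; rewrite -[x]scale1r; apply: cl.
Qed.

Lemma hpartZ {i} k {x : W} : x \in hpart W i -> k *: x \in hpart W i.
Proof.
by have [z0 cl] := hpart_submod W i => xi; rewrite -[_ *: _]addr0; apply: cl.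
Qed.

(** The defects of additivity [d false] and [d true] lie in opposite parts and add up to zero, so
    each lies in both parts and vanishes by [hpart_cap]. *)
Lemma hprojD i : {morph hproj W i : x y / x + y}.
Proof.
have sub_mem j (x y : W) :
    x \in hpart W j -> y \in hpart W j -> x - y \in hpart W j.
  by move=> xj yj; rewrite -scaleN1r; apply: hpartD => //; apply: hpartZ.
move=> x y; pose d j := hproj W j (x + y) - (hproj W j x + hproj W j y).
have dj j : d j \in hpart W j.
  by apply: sub_mem; [|apply: hpartD]; apply: hproj_in.
have d0 : d false + d true = 0.
  rewrite /d addrACA -opprD addrACA !hproj_sum; exact: subrr.
have d1 : d true = 0.
  apply: hpart_cap (dj true); rewrite -[d true]opprK -scaleN1r.
  by apply: hpartZ; rewrite -(addr0_eq d0) opprK; apply: dj.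
apply/subr0_eq; case: i; first exact: d1.
by move: d0; rewrite d1 addr0.
Qed.

Lemma hproj_linear i : linear (hproj W i).
Proof.
move=> k x y; rewrite hprojD; congr (_ + _).
rewrite -{1}(hproj_sum W x) scalerDr hprojD.
rewrite !(hproj_hom (Defs.Hom (hpartZ k (hproj_in W _ x)))) /=.
by case: i; rewrite ?addr0 ?add0r.
Qed.

(** An even linear map commutes with the projections. So if [x] has parity [i], its preimage [y] and
    [hproj W i y] have the same image, and injectivity identifies them. *)
Lemma even_bij_inv {f : W -> W} (fb : bijective f) :
  linear f -> even_map f -> even_map (bij_inv fb).
Proof.
move=> fl fe i x xi; rewrite addbF; set y := bij_inv fb x.
have hc j : f (hproj W j y) = hproj W j x.
  rewrite -[x in RHS](bij_invK fb) -/y -[y in RHS](hproj_sum W).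
  rewrite (linear_funD fl) hprojD.
  rewrite !(hproj_hom (Defs.Hom (fe _ _ (hproj_in W _ y)))) /=.
  by case: j; rewrite ?addr0 ?add0r.
suff -> : y = hproj W i y by apply: hproj_in.
apply: (bij_inj fb); rewrite hc (bij_invK fb).
by rewrite (hproj_hom (Defs.Hom xi)) eqxx.
Qed.

End Grading.

(** * Even operators with a sign-twisted product *)

Section EvenTwistedOperator.
Context {K : fieldType} {J : superspace K}.
Context {mul : J -> J -> J} {a b : J -> J}.
Context {A : superspace K} {rho : J -> A -> A} {aA bA : A -> A}.
Variable rep : is_representation mul a b rho aA bA.
Let ai := bij_inv (rep_a_bij rep).
Let bi := bij_inv (rep_b_bij rep).
(** In the applications [p] is the parity of [T] on [V], and [A] is [V] or [shift V] accordingly. A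
    vector of parity [i] in [A] has parity [i (+) p] in [V], which turns the exponent
    [p * (|u| + p)] of the product into [p * i]. *)
Variables (p : bool) (T : A -> J) (op : A -> A -> A).
Hypothesis T_even : even_map T.
Hypothesis T_a : forall v, a (T v) = T (aA v).
Hypothesis T_b : forall v, b (T v) = T (bA v).
Hypothesis op_bilinear : is_bilinear op.
Hypothesis opE : forall {i u} v, u \in hpart A i ->
  op u v = (-1) ^+ (p * i) *: rho (T u) v.
Hypothesis T_mul : forall u v : homog A,
  mul (T u) (T v)
  = T (op u v + (-1) ^+ (par u * par v) *: op (ai (bA v)) (aA (bi u))).

Let star := pre_star op aA bA ai bi.

Let aP {i x} : x \in hpart A i -> aA x \in hpart A i.
Proof. by move=> /(rep_a_even rep); rewrite addbF. Qed.

Let bP {i x} : x \in hpart A i -> bA x \in hpart A i.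
Proof. by move=> /(rep_b_even rep); rewrite addbF. Qed.

Let TP {i x} : x \in hpart A i -> T x \in hpart J i.
Proof. by move=> /T_even; rewrite addbF. Qed.

Let op_even : even_bimap op.
Proof.
move=> i j x y xi yj; rewrite (opE _ xi); apply: hpartZ.
by apply: (rep_even rep) => //; apply: TP.
Qed.

Let starE {i j x y} : x \in hpart A i -> y \in hpart A j ->
  star x y = op x y + (-1) ^+ (i * j) *: op (ai (bA y)) (aA (bi x)).
Proof.
have [opr opl] := op_bilinear.
have [al bl] := (rep_a_linear rep, rep_b_linear rep).
(* [bilin_extE] applies only if the formula vanishes as soon as one argument is zero, inverse maps
   included. *)
have ai0 : ai 0 = 0 by rewrite -{1}(linear_fun0 al) /ai bijK_inv.
have bi0 : bi 0 = 0 by rewrite -{1}(linear_fun0 bl) /bi bijK_inv.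
have op0l v : op 0 v = 0 := linear_fun0 (opl v).
have op0r u : op u 0 = 0 := linear_fun0 (opr u).
move=> xi yj; rewrite /star /pre_star.
rewrite (@bilin_extE _ _ _ _ _ (Defs.Hom xi) (Defs.Hom yj)) //= => k l v.
  by rewrite bi0 (linear_fun0 al) op0l op0r scaler0 addr0.
by rewrite (linear_fun0 bl) ai0 op0l op0r scaler0 addr0.
Qed.

Let starP {i j x y} : x \in hpart A i -> y \in hpart A j ->
  star x y \in hpart A (i (+) j).
Proof.
move=> xi yj; rewrite (starE xi yj); apply: hpartD; first exact: op_even.
have [ae be] := (rep_a_even rep, rep_b_even rep).
have aiy : ai (bA y) \in hpart A j.
  have := even_bij_inv (rep_a_bij rep) (rep_a_linear rep) ae _ _ (bP yj).
  by rewrite addbF.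
have bix : bi x \in hpart A i.
  have := even_bij_inv (rep_b_bij rep) (rep_b_linear rep) be _ _ xi.
  by rewrite addbF.
by apply: hpartZ; rewrite addbC; apply: op_even => //; apply: aP.
Qed.

Let T_star {i j x y} : x \in hpart A i -> y \in hpart A j ->
  T (star x y) = mul (T x) (T y).
Proof.
by move=> xi yj; rewrite (T_mul (Defs.Hom xi) (Defs.Hom yj)) (starE xi yj).
Qed.

(** Linearity of [rho (T x)] moves the inner sign out, and exponents of -1 matter only modulo 2. In
    this and the next normal forms the sign depends only on the total parity of the acting vectors,
    so permuting them does not change it. *)
Let op2E {i j x y t} : x \in hpart A i -> y \in hpart A j ->
  op x (op y t) = (-1) ^+ (p * (i (+) j)) *: rho (T x) (rho (T y) t).
Proof.
move=> xi yj; have [rr _] := rep_bilinear rep.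
rewrite (opE _ xi) (opE _ yj) (linear_funZ (rr _)) scalerA.
by rewrite !mulnb andb_addr signr_addb.
Qed.

Let op3E {i j k x y z t} :
  x \in hpart A i -> y \in hpart A j -> z \in hpart A k ->
  op x (op y (op z t))
  = (-1) ^+ (p * (i (+) j (+) k)) *: rho (T x) (rho (T y) (rho (T z) t)).
Proof.
move=> xi yj zk; have [rr _] := rep_bilinear rep.
rewrite (op2E xi yj) (opE _ zk) !(linear_funZ (rr _)) scalerA.
by rewrite !mulnb !andb_addr !signr_addb.
Qed.

Let star_opE {i j k x y z t} :
  x \in hpart A i -> y \in hpart A j -> z \in hpart A k ->
  op (star x y) (op z t)
  = (-1) ^+ (p * (i (+) j (+) k)) *: rho (mul (T x) (T y)) (rho (T z) t).
Proof. by move=> xi yj zk; rewrite (op2E (starP xi yj) zk) (T_star xi yj). Qed.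

Let op_starE {i j k x y z t} :
  x \in hpart A i -> y \in hpart A j -> z \in hpart A k ->
  op x (op (star y z) t)
  = (-1) ^+ (p * (i (+) j (+) k)) *: rho (T x) (rho (mul (T y) (T z)) t).
Proof.
by move=> xi yj zk; rewrite (op2E xi (starP yj zk)) (T_star yj zk) addbA.
Qed.

Let star_starE {i j k x y z t} :
  x \in hpart A i -> y \in hpart A j -> z \in hpart A k ->
  op (star (star x y) z) t
  = (-1) ^+ (p * (i (+) j (+) k)) *: rho (mul (mul (T x) (T y)) (T z)) t.
Proof.
move=> xi yj zk; rewrite (opE _ (starP (starP xi yj) zk)).
by rewrite (T_star (starP xi yj) zk) (T_star xi yj).
Qed.

Lemma even_twisted_operator_prejordan : is_bihom_prejordan op aA bA.
Proof.
have [al bl] := (rep_a_linear rep, rep_b_linear rep).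
have scale_swap c e (w : A) : c *: (e *: w) = e *: (c *: w).
  by rewrite !scalerA mulrC.
refine (@IsBiHomPreJordan _ _ op aA bA op_bilinear op_even al bl
  (rep_a_even rep) (rep_b_even rep) (rep_a_bij rep) (rep_b_bij rep)
  (rep_ab rep) _ _ _ _).
- move=> [x i xi] y /=; rewrite (opE _ xi) (opE _ (aP xi)).
  by rewrite (linear_funZ al) (rep_R1a rep (Defs.Hom (TP xi))) /= T_a.
- move=> [x i xi] y /=; rewrite (opE _ xi) (opE _ (bP xi)).
  by rewrite (linear_funZ bl) (rep_R1b rep (Defs.Hom (TP xi))) /= T_b.
- move=> [x i xi] [y j yj] [z k zk] [t l tl] /=.
  have := rep_R2 rep (Defs.Hom (TP xi)) (Defs.Hom (TP yj)) (Defs.Hom (TP zk)) t.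
  (* Moving [a] and [b] inside [T] gives (R2) the arguments that the normal forms produce. *)
  rewrite /cyclic_sum /= -/star -/bi !(T_a, T_b) => R2.
  rewrite (star_opE (aP (bP (bP xi))) (aP (aP (bP yj))) (aP (aP (bP zk)))).
  rewrite (star_opE (aP (bP (bP yj))) (aP (aP (bP zk))) (aP (aP (bP xi)))).
  rewrite (star_opE (aP (bP (bP zk))) (aP (aP (bP xi))) (aP (aP (bP yj)))).
  rewrite (star_starE (bP (bP xi)) (aP (bP yj)) (aP (aP (bP zk)))).
  rewrite (op3E (aP (aP (bP (bP xi)))) (aP (aP (bP zk))) (aP (aP yj))).
  rewrite (op3E (aP (aP (bP (bP yj)))) (aP (aP (bP zk))) (aP (aP xi))).
  (* With all total parities written alike, the twist is a common factor of both sides, and (R2)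
     remains. *)
  have -> : j (+) k (+) i = i (+) j (+) k by rewrite addbC addbA.
  have -> : k (+) i (+) j = i (+) j (+) k by rewrite -addbA addbC.
  have -> : i (+) k (+) j = i (+) j (+) k by rewrite addbAC.
  by rewrite !(scale_swap _ ((-1) ^+ (p * _))) -!scalerDr R2.
- move=> [x i xi] [y j yj] [z k zk] [t l tl] /=.
  have := rep_R3 rep (Defs.Hom (TP xi)) (Defs.Hom (TP yj)) (Defs.Hom (TP zk)) t.
  rewrite /cyclic_sum /= -/star !(T_a, T_b) => R3.
  rewrite (star_opE (aP (bP (bP xi))) (aP (aP (bP yj))) (aP (aP (bP zk)))).
  rewrite (star_opE (aP (bP (bP yj))) (aP (aP (bP zk))) (aP (aP (bP xi)))).
  rewrite (star_opE (aP (bP (bP zk))) (aP (aP (bP xi))) (aP (aP (bP yj)))).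
  rewrite (op_starE (aP (aP (bP (bP xi)))) (aP (bP yj)) (aP (aP zk))).
  rewrite (op_starE (aP (aP (bP (bP yj)))) (aP (bP zk)) (aP (aP xi))).
  rewrite (op_starE (aP (aP (bP (bP zk)))) (aP (bP xi)) (aP (aP yj))).
  have -> : j (+) k (+) i = i (+) j (+) k by rewrite addbC addbA.
  have -> : k (+) i (+) j = i (+) j (+) k by rewrite -addbA addbC.
  by rewrite !(scale_swap _ ((-1) ^+ (p * _))) -!scalerDr R3.
Qed.

End EvenTwistedOperator.

(** * The product induced by [T], and the passage to sV *)

Lemma O_prod_proj {K : fieldType} {J V : superspace K} {rho : J -> V -> V}
    {p : bool} {T : V -> J} : is_bilinear rho -> linear T -> forall u v,
  O_prod rho p T u v
  = rho (T ((-1) ^+ p *: hproj V false u + hproj V true u)) v.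
Proof.
move=> [rr rl] Tl u v; rewrite /O_prod /bilin_ext !big_bool /=.
rewrite -!scalerDr -!(linear_funD (rr _)) [hproj V true v + _]addrC hproj_sum.
rewrite -!(linear_funZ (rl v)) -(linear_funD (rl v)) -!(linear_funZ Tl).
(* The sign depends on [u] alone, so it is absorbed into its components: modulo 2 the exponent
   [p * (i + p)] is [p] on the even part and 0 on the odd part. *)
rewrite -(linear_funD Tl) addrC mulnb; congr (rho (T (_ + _)) _).
  by case: p.
by case: p; rewrite /= ?muln0 ?expr0 ?sqrrN ?expr1n scale1r.
Qed.

Lemma O_prod_bilinear {K : fieldType} {J V : superspace K} {rho : J -> V -> V}
    {p : bool} {T : V -> J} : is_bilinear rho -> linear T ->
  is_bilinear (O_prod rho p T).
Proof.
move=> rhoB Tl; have [rr rl] := rhoB; split=> [u k v w|v k u w].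
  by rewrite !(O_prod_proj rhoB Tl) rr.
rewrite !(O_prod_proj rhoB Tl) !hproj_linear -rl -Tl; congr (rho (T _) _).
by rewrite !scalerDr !scalerA [k * _]mulrC addrACA.
Qed.

Lemma O_prod_hom {K : fieldType} {J V : superspace K} {rho : J -> V -> V}
    {p : bool} {T : V -> J} {i u} v : is_bilinear rho -> linear T ->
  u \in hpart V i ->
  O_prod rho p T u v = (-1) ^+ (p * (i (+) p)) *: rho (T u) v.
Proof.
move=> rhoB Tl ui; have [rr rl] := rhoB; rewrite (O_prod_proj rhoB Tl).
rewrite -(linear_funZ (rl v)) -(linear_funZ Tl) !(hproj_hom (Defs.Hom ui)).
by case: i p ui => [] [] _ /=; rewrite ?scaler0 ?addr0 ?add0r ?scale1r.
Qed.

(* [bij_inv] depends on an opaque proof indexed by the superspace, so the two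
inverses below are not convertible. *)
Lemma bij_inv_shift {K : fieldType} {V : superspace K} {f : V -> V}
    (fb : bijective f) (fbs : @bijective (shift V) (shift V) f) (x : V) :
  @bij_inv K (shift V) f fbs x = bij_inv fb x.
Proof.
apply: (bij_inj fb).
exact: etrans (@bij_invK K (shift V) f fbs x) (esym (bij_invK fb x)).
Qed.

(** The signs in (R2) and (R3) involve parities in [J] only, so regrading the module leaves the
    identities intact. Evenness survives because source and target parities flip together. *)
Lemma shift_representation {K : fieldType} {J V : superspace K}
    {mul : J -> J -> J} {a b : J -> J} {rho : J -> V -> V} {aV bV : V -> V} :
  is_representation mul a b rho aV bV ->
  @is_representation K J mul a b (shift V) rho aV bV.
Proof.
case=> rhoB rho_even al bl ae be ab bb abC R1a R1b R2 R3.
apply: (@IsRepresentation K J mul a b (shift V) rho aV bV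
  rhoB _ al bl _ _ ab bb).
- move=> i j x y xi yj; have := rho_even _ _ _ _ xi yj.
  by rewrite /= addbN.
- by move=> i x /ae; rewrite !addbF.
- by move=> i x /be; rewrite !addbF.
- exact: abC.
- exact: R1a.
- exact: R1b.
- by move=> x y z v /=; rewrite (bij_inv_shift bb bb); apply: R2.
- exact: R3.
Qed.

Theorem theorem4p5
  (K : closedFieldType) (charK : [pchar K] =i pred0)
  (J : superspace K) (mul : J -> J -> J) (alpha beta : J -> J)
  (hJ : is_bihom_jordan mul alpha beta)
  (hmult : is_multiplicative mul alpha beta)
  (hreg : is_regular mul alpha beta)
  (V : superspace K) (rho : J -> V -> V) (alphaV betaV : V -> V)
  (hV : is_representation mul alpha beta rho alphaV betaV)
  (p : bool) (T : V -> J) (hT : is_O_operator hV p T) :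
  (p = false -> is_bihom_prejordan (O_prod rho p T) alphaV betaV) /\
  (p = true ->
     is_bihom_prejordan (shift_prod (O_prod rho p T))
       (shift_map alphaV) (shift_map betaV)).
Proof.
have rhoB := rep_bilinear hV; have [Tl Th Ta Tb Tm] := hT.
(* This vector is the left factor of the second term of the star product, so its parity is needed to
   evaluate that product. *)
have abP j v : v \in hpart V j ->
    bij_inv (rep_a_bij hV) (betaV v) \in hpart V j.
  move=> /(rep_b_even hV); rewrite addbF => bvj.
  have := even_bij_inv (rep_a_bij hV) (rep_a_linear hV) (rep_a_even hV) _ _ bvj.
  by rewrite addbF.
split=> pE; subst p.
  apply: (even_twisted_operator_prejordan hV false T _ Th Ta Tb).
  - exact: O_prod_bilinear.
  - by move=> i u v ui; rewrite (O_prod_hom _ rhoB Tl ui).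
  - move=> [u i ui] [v j vj] /=; rewrite (Tm (Defs.Hom ui) (Defs.Hom vj)) /=.
    rewrite (O_prod_hom _ rhoB Tl ui) (O_prod_hom _ rhoB Tl (abP _ _ vj)).
    by rewrite !mul0n addn0 [in RHS]expr0 !scale1r.
have hS := shift_representation hV.
apply: (@even_twisted_operator_prejordan K J mul alpha beta (shift V) rho
  alphaV betaV hS true T _ _ Ta Tb).
(* The parity flip of sV cancels that of the odd [T]. *)
- by move=> i u ui; have := Th _ _ ui; rewrite addbT negbK addbF.
- exact: O_prod_bilinear rhoB Tl.
- move=> i u v ui; rewrite /shift_prod /s_map /s_inv (O_prod_hom _ rhoB Tl ui).
  by rewrite addbT negbK.
- move=> [u i ui] [v j vj] /=; rewrite /shift_prod /s_map /s_inv.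
  rewrite (Tm (@Defs.Hom K V u (~~ i) ui) (@Defs.Hom K V v (~~ j) vj)) /=.
  rewrite !(bij_inv_shift (rep_a_bij hV)) !(bij_inv_shift (rep_b_bij hV)).
  rewrite (O_prod_hom _ rhoB Tl ui) (O_prod_hom _ rhoB Tl (abP _ _ vj)).
  (* With [i] and [j] the parities in sV, modulo 2 both sides have exponent [i] on the first term.
     On the second, [(i + 1) * j] from the O-operator identity equals [i * j] from the star product
     plus [j] from [O_prod]. *)
  case: i j ui vj => [] [] _ _ /=;
  by rewrite !(mul0n, mul1n, muln0, addn1, expr0, expr1, sqrrN,
                expr1n, scale1r, scaleN1r, opprK).
Qed.
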